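(* Let $S$ be a finite $E$-dense semigroup whose set of idempotents $E$ is a semilattice, let $s\in S$, let $X$ be a (total, left) $S$-act, and let $f$ be the minimum idempotent in $S$. Then $(X,s)$ is a locally free $S$-cryptosystem if and only if $X$ is isomorphic to a disjoint union of copies of the $S$-act $Sf$. In addition, if $S$ is $E$-unitary (and $(X,s)$ is a locally free $S$-cryptosystem) then for each $x\in X$, $|K(s,x)|=|(W(s))\omega|$.
   Context: For a semigroup $S$, $E=E(S)$ is its set of idempotents and $W(s)=\{s'\in S\mid s'ss'=s'\}$. $S$ is $E$-dense if for every $s\in S$ there are $t,u\in S$ with $ts\in E$ and $su\in E$ (equivalently $W(s)\neq\emptyset$ for all $s$). $E$ is a semilattice if it is a subsemigroup and its elements commute. $S$ is $E$-unitary if for all $t\in S$, $e\in E$, $te\in E$ or $et\in E$ implies $t\in E$. Partial order on $S$: $s\le t$ iff $s=t$ or there are $e,g\in E$ with $s=te=gt$. For $A\subseteq S$, $A\omega=\{t\in S\mid a\le t\text{ for some }a\in A\}$. The minimum idempotent is minimum with respect to $\le$ on $E$. A (total, left) $S$-act is a nonempty set $X$ with a map $S\times X\to X$, $(s,x)\mapsto sx$, with $(st)x=s(tx)$ for all $s,t\in S$, $x\in X$ (and $1x=x$ if $S$ is a monoid). It is cancellative if for all $t\in S$, $x,y\in X$, $tx=ty$ implies $x=y$. An $S$-cryptosystem $(X,s)$ consists of a cancellative total $S$-act $X$ and an element $s\in S$. For $x\in X$, $S_x=\{t\in S\mid tx=x\}$, and $K(s,x)=\{t\in S\mid ts\in S_x\}$.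 A cancellative $S$-act $X$ (and the cryptosystem $(X,s)$) is locally free if $S_x=E\omega$ for all $x\in X$. The $S$-act $Sf=\{tf\mid t\in S\}$ carries the action by left multiplication in $S$. Disjoint unions are over nonempty index sets, with $S$ acting on each component; isomorphisms of total $S$-acts are bijections $\phi$ with $\phi(tx)=t\phi(x)$ for all $t\in S$. *)

(* Defs.v *)
From HB Require Import structures.
From mathcomp Require Import all_boot.
From mathcomp Require Import boolp classical_sets functions cardinality.

Set Implicit Arguments.
Unset Strict Implicit.
Unset Printing Implicit Defensive.

Local Open Scope classical_set_scope.
Local Open Scope group_scope.

Section Semigroup.
Variable S : semigroupType.
Implicit Types (s t e g : S) (A : set S).

Definition idempotents : set S := [set e | e * e = e].

Definition weak_inverses s : set S := [set s' | s' * s * s' = s'].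

Definition e_dense : Prop :=
  forall s, exists t u, idempotents (t * s) /\ idempotents (s * u).

Definition semilattice_idempotents : Prop :=
  forall e g, idempotents e -> idempotents g ->
    idempotents (e * g) /\ e * g = g * e.

Definition e_unitary : Prop :=
  forall t e, idempotents e ->
    idempotents (t * e) \/ idempotents (e * t) -> idempotents t.

Definition sle s t : Prop :=
  s = t \/
  exists e g, [/\ idempotents e, idempotents g, s = t * e & s = g * t].

(* A\omega *)
Definition upclosure A : set S := [set t | exists2 a, A a & sle a t].

Definition min_idempotent e : Prop :=
  idempotents e /\ forall g, idempotents g -> sle e g.

(* In [act1], [e] ranges over the two-sided identities of S: the axiom is
   vacuous unless S is a monoid. *)
Record sact := Sact {
  carrier :> Type;
  act : S -> carrier -> carrier;
  act_nonempty : inhabited carrier;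
  actM : forall s t x, act (s * t) x = act s (act t x);
  act1 : forall e, (forall t, e * t = t /\ t * e = t) -> forall x, act e x = x
}.

Definition cancellative_act (X : sact) : Prop :=
  forall t (x y : X), act t x = act t y -> x = y.

Definition stabilizer (X : sact) (x : X) : set S := [set t | act t x = x].

Definition key_set s (X : sact) (x : X) : set S :=
  [set t | stabilizer x (t * s)].

(* The pair (X, s) is an S-cryptosystem; only X carries a condition. *)
Definition cryptosystem (X : sact) (s : S) : Prop := cancellative_act X.

Definition locally_free_cryptosystem (X : sact) (s : S) : Prop :=
  cryptosystem X s /\ forall x : X, stabilizer x = upclosure idempotents.

Definition act_isomorphic (X Y : sact) : Prop :=
  exists2 phi : X -> Y, bijective phi &
    forall t x, phi (act t x) = act t (phi x).

Section PrincipalAct.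
Variable f : S.

(* The set Sf, without an identity adjoined to S. *)
Definition principal_carrier : Type := {u : S | exists t, u = t * f}.

Lemma principal_closed s (u : principal_carrier) :
  exists t, s * sval u = t * f.
Proof. by case: u => _ /= [t ->]; exists (s * t); rewrite mulgA. Qed.

Definition principal_mul s (u : principal_carrier) : principal_carrier :=
  exist _ (s * sval u) (principal_closed s u).

Lemma principal_nonempty : inhabited principal_carrier.
Proof. by constructor; exists (f * f); exists f. Qed.

Lemma principal_mulM s t u :
  principal_mul (s * t) u = principal_mul s (principal_mul t u).
Proof. by apply: eq_exist; rewrite /= mulgA. Qed.

Lemma principal_mul1 e : (forall t, e * t = t /\ t * e = t) ->
  forall u, principal_mul e u = u.
Proof. by move=> e1 [u fu]; apply: eq_exist; rewrite /= (e1 u).1. Qed.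

Definition principal_act : sact :=
  Sact principal_nonempty principal_mulM principal_mul1.

End PrincipalAct.

Section DisjointUnion.
Variables (I : Type) (I0 : inhabited I) (X : I -> sact).

Definition union_act s (p : {i : I & X i}) : {i : I & X i} :=
  existT _ (projT1 p) (act s (projT2 p)).

Lemma union_nonempty : inhabited {i : I & X i}.
Proof. by case: I0 => i; case: (act_nonempty (X i)) => x; split; exists i. Qed.

Lemma union_actM s t p : union_act (s * t) p = union_act s (union_act t p).
Proof. by rewrite /union_act actM. Qed.

Lemma union_act1 e : (forall t, e * t = t /\ t * e = t) ->
  forall p, union_act e p = p.
Proof. by move=> e1 [i x]; rewrite /union_act /= act1. Qed.

Definition disjoint_union : sact := Sact union_nonempty union_actM union_act1.

End DisjointUnion.

End Semigroup.

Arguments idempotents : clear implicits.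
Arguments e_dense : clear implicits.
Arguments semilattice_idempotents : clear implicits.
Arguments e_unitary : clear implicits.

(* Main.v *)
Require Import Defs.
From mathcomp Require Import all_boot.
From mathcomp Require Import boolp classical_sets functions cardinality.

(** The minimum idempotent [f] absorbs every idempotent, hence is central:
    for a weak inverse [t'] of [t] both [t * f * t'] and [t' * f * t] are
    idempotent, and absorbing them gives [f * t = f * t * f = t * f]
    ([min_idempotentC]).  Consequently [Sf] is a group with identity [f], and
    [t |-> t * f] maps [S] onto it: a weak inverse of [t] becomes the inverse
    of [t * f] ([min_idempotent_invertible]).  The kernel of this map is
    E\omega ([upclosure_idempotentsE]), so an act is locally free exactly when
    it is, through this map, a free action of the group [Sf] in which the
    identity [f] fixes every point.

    The first claim is then the decomposition of a free group action into
    regular orbits.  In the direct sense, [f] fixes every point, so [S] acts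
    through [Sf]; choosing a base point [r O] in each orbit [O] makes
    [(O, u) |-> u (r O)] an equivariant bijection from the disjoint union of
    copies of [Sf] ([locally_free_decomposition]).  Conversely [Sf] is
    cancellative with stabilizers E\omega, and both properties pass to
    disjoint unions and to isomorphic acts.

    For the second claim, the sets [K(s,x)] and [W(s)\omega] are not only
    equinumerous but equal: both consist of the [t] such that [t * f] is the
    inverse of [s * f], that is [t * s * f = f].  For [W(s)\omega] the point is
    that [t * f] is then itself a weak inverse of [s] lying below [t]
    ([upclosure_weak_inversesE]). *)

Set Implicit Arguments.
Unset Strict Implicit.
Unset Printing Implicit Defensive.

Local Open Scope classical_set_scope.
Local Open Scope card_scope.

(** * The group generated by the minimum idempotent *)

Section MinimumIdempotent.
Local Open Scope group_scope.
Variable S : semigroupType.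
Hypotheses (S_dense : e_dense S) (S_slat : semilattice_idempotents S).

Lemma idempotentsE (e : S) : idempotents S e = (e * e = e).
Proof. by []. Qed.

Lemma weak_inversesE (s s' : S) : weak_inverses s s' = (s' * s * s' = s').
Proof. by []. Qed.

(** The witness is [t * s * t], where [t * s] is idempotent. *)
Lemma weak_inverse_exists (s : S) : exists s', weak_inverses s s'.
Proof.
have [t [_ [+ _]]] := S_dense s; rewrite idempotentsE mulgA => tsE.
by exists (t * s * t); rewrite weak_inversesE !mulgA !tsE.
Qed.

Lemma weak_inverse_idempotents {s s' : S} :
  weak_inverses s s' -> idempotents S (s' * s) /\ idempotents S (s * s').
Proof.
rewrite weak_inversesE => ws; split; rewrite idempotentsE.
- by rewrite mulgA ws.
- by rewrite -mulgA (mulgA s') ws.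
Qed.

(** Commuting [e] past the idempotents [s' * s] and [s * s'] brings the two
    copies of [e] together. *)
Lemma weak_inverse_conj {s s' e : S} : weak_inverses s s' -> idempotents S e ->
  idempotents S (s * e * s') /\ idempotents S (s' * e * s).
Proof.
move=> ws eE; have [s'sE ss'E] := weak_inverse_idempotents ws.
have [_ c1] := S_slat s'sE eE; have [_ c2] := S_slat ss'E eE.
move: ws eE; rewrite weak_inversesE idempotentsE => ws eE.
split; rewrite idempotentsE.
- have -> : s * e * s' * (s * e * s') = s * e * (s' * s * e) * s'
    by rewrite !mulgA.
  rewrite c1 mulgA -(mulgA s e e) eE.
  by rewrite -(mulgA (s * e) (s' * s)) ws.
- have -> : s' * e * s * (s' * e * s) = s' * e * (s * s' * e) * s
    by rewrite !mulgA.
  have -> : s' * e * (s * s' * e) * s = s' * (e * (s * s')) * e * s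
    by rewrite !mulgA.
  by rewrite -c2 !mulgA ws -(mulgA s' e e) eE.
Qed.

Variable f : S.
Hypothesis f_min : min_idempotent f.

Lemma min_idempotent_absorb {e} : idempotents S e -> f * e = f /\ e * f = f.
Proof.
move=> eE; have [fE /(_ e eE)] := f_min.
case=> [<- //|[g [h [_ _ fg fh]]]]; split.
- by rewrite fh -mulgA eE.
- by rewrite fg mulgA eE.
Qed.

(** Both [f * t] and [t * f] equal [f * t * f]: for the first, [f] absorbs
    [t * f * t'] on the right, for the second, [t' * f * t] on the left. *)
Lemma min_idempotentC t : f * t = t * f.
Proof.
have [fE _] := f_min; have [t' wt] := weak_inverse_exists t.
have [/min_idempotent_absorb[ft't _] /min_idempotent_absorb[_ tt'f]] :=
  weak_inverse_idempotents wt.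
have [/min_idempotent_absorb[ftft' _] /min_idempotent_absorb[_ t'ftf]] :=
  weak_inverse_conj wt fE.
have ftf : f * t * f = f * t.
  rewrite -[in RHS]ftft' -!mulgA; congr (f * (t * _)).
  by rewrite ft't.
by rewrite -[in RHS]t'ftf !mulgA tt'f ftf.
Qed.

Lemma min_idempotent_invertible t :
  exists t', t' * t * f = f /\ t * t' * f = f.
Proof.
have [t' wt] := weak_inverse_exists t; exists t'.
by have [/min_idempotent_absorb[_ ?] /min_idempotent_absorb[_ ?]] :=
  weak_inverse_idempotents wt.
Qed.

(** Above an idempotent, [f] is absorbed as by that idempotent; conversely
    [t * f = f] exhibits [f] itself below [t]. *)
Lemma upclosure_idempotentsE :
  upclosure (idempotents S) = [set t | t * f = f].
Proof.
have [fE _] := f_min; apply/seteqP; split => t /=.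
- move=> [e eE [et|[g [h [gE _ etg _]]]]].
    by rewrite -et (min_idempotent_absorb eE).2.
  by rewrite -[in LHS](min_idempotent_absorb gE).2 mulgA -etg
    (min_idempotent_absorb eE).2.
- move=> tf; exists f => //; right; exists f, f; split=> //.
  by rewrite min_idempotentC.
Qed.

(** If [s' <= t] for a weak inverse [s'], then [f * s' = f * t], so [t * f] is
    the inverse of [s * f] because [s' * f] is; conversely that inverse is
    itself a weak inverse of [s], and it lies below [t] since [f] is central. *)
Lemma upclosure_weak_inversesE s :
  upclosure (weak_inverses s) = [set t | t * s * f = f].
Proof.
have [fE _] := f_min; apply/seteqP; split => t /=.
- move=> [s' ws]; have [s'sE _] := weak_inverse_idempotents ws.
  have [fs's s'sf] := min_idempotent_absorb s'sE.
  case=> [<- //|[g [h [_ hE _ s'ht]]]].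
  rewrite -min_idempotentC -[in LHS](min_idempotent_absorb hE).1.
  by rewrite -mulgA (mulgA h) -s'ht.
- move=> tsf; exists (t * f).
    rewrite weak_inversesE.
    have -> : t * f * s * (t * f) = t * (f * s) * (t * f) by rewrite !mulgA.
    by rewrite min_idempotentC (mulgA t s) tsf -min_idempotentC mulgA fE.
  by right; exists f, f; split=> //; rewrite min_idempotentC.
Qed.

(** * Acts whose stabilizers are the kernel of the projection onto the group *)

Lemma principal_mulf {u : S} : (exists t, u = t * f) -> u * f = u.
Proof. by have [fE _] := f_min; move=> [t ->]; rewrite -mulgA fE. Qed.

(** A point of [Sf] is invertible modulo [f], so it is fixed by [t] only when
    [f] is. *)
Lemma principal_act_locally_free s :
  locally_free_cryptosystem (principal_act f) s.
Proof.
split=> [t [u fu] [v fv] /(congr1 sval)/= tuv|[u fu]].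
  apply: eq_exist => /=; have [t' [t't _]] := min_idempotent_invertible t.
  rewrite -(principal_mulf fu) -(principal_mulf fv) -!min_idempotentC.
  by rewrite -t't -!mulgA !min_idempotentC !(principal_mulf fu, principal_mulf fv)
    tuv.
rewrite upclosure_idempotentsE; apply/seteqP; split=> t /=.
- move=> /(congr1 sval)/= tu; have [u' [_ uu']] := min_idempotent_invertible u.
  by rewrite -[in LHS]uu' !mulgA tu.
- move=> tf; apply: eq_exist => /=.
  by rewrite -[in LHS](principal_mulf fu) -min_idempotentC mulgA tf
    min_idempotentC (principal_mulf fu).
Qed.

Lemma disjoint_union_locally_free s (I : Type) (I0 : inhabited I)
    (X : I -> sact S) : (forall i, locally_free_cryptosystem (X i) s) ->
  locally_free_cryptosystem (disjoint_union I0 X) s.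
Proof.
have inj2 i (x y : X i) : existT (fun i => X i) i x = existT _ i y -> x = y.
  (* [I] need not have decidable equality: the transport along a loop at [i]
     is trivial by proof irrelevance. *)
  move=> xy; have := projT2_eq xy => /=.
  by rewrite (Prop_irrelevance (projT1_eq xy) erefl).
move=> lfX; split=> [t [i x] [j y] txy|[i x]].
  have ij : i = j := projT1_eq txy.
  case: j / ij y txy => y /inj2 txy.
  by have -> : x = y := (lfX i).1 t x y txy.
rewrite -((lfX i).2 x); apply/seteqP; split=> t /=.
- exact: inj2.
- exact: (congr1 (existT (fun i => X i) i)).
Qed.

Lemma act_isomorphic_locally_free s (X Y : sact S) : act_isomorphic X Y ->
  locally_free_cryptosystem Y s -> locally_free_cryptosystem X s.
Proof.
move=> [phi /bij_inj phi_inj phiM] [cancY stabY]; split=> [t x y txy|x].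
  by apply/phi_inj/(cancY t); rewrite -!phiM txy.
rewrite -(stabY (phi x)); apply/seteqP; split=> t tx.
- by rewrite /stabilizer /= -phiM tx.
- by apply: phi_inj; rewrite phiM tx.
Qed.

(** * Decomposition of a locally free act into orbits *)

Lemma act_isomorphic_from (X Y : sact S) (psi : Y -> X) :
  injective psi -> (forall x, exists y, psi y = x) ->
  (forall t y, psi (act t y) = act t (psi y)) -> act_isomorphic X Y.
Proof.
move=> psi_inj /choice[phi phiK] psiM; exists phi.
  by exists psi => // y; apply: psi_inj; rewrite phiK.
by move=> t x; apply: psi_inj; rewrite psiM !phiK.
Qed.

Section LocallyFree.
Variables (s : S) (X : sact S).
Hypothesis X_lf : locally_free_cryptosystem X s.

Lemma act_fixE t (x : X) : act t x = x <-> t * f = f.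
Proof.
have <- : stabilizer x t = (act t x = x) by [].
by rewrite X_lf.2 upclosure_idempotentsE.
Qed.

Lemma act_min (x : X) : act f x = x.
Proof. by apply/act_fixE; have [] := f_min. Qed.

Lemma act_inverse t : exists t',
  [/\ t' * t * f = f, t * t' * f = f & forall x : X, act t' (act t x) = x].
Proof.
have [t' [t't tt']] := min_idempotent_invertible t.
by exists t'; split=> // x; rewrite -actM; apply/act_fixE.
Qed.

(** Freeness: [a x = b x] forces [a^-1 b] into the stabilizer of [x]. *)
Lemma act_free a b (x : X) : act a x = act b x -> a * f = b * f.
Proof.
have [a' [_ aa'f a'K]] := act_inverse a.
move=> /(congr1 (act a')); rewrite a'K -actM => /esym/act_fixE a'bf.
have -> : b * f = a * a' * f * b.
  by rewrite aa'f min_idempotentC.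
by rewrite -(mulgA _ f) min_idempotentC -(mulgA a) (mulgA a') a'bf.
Qed.

Definition orbit (x : X) : set X := [set y | exists t, act t x = y].

Lemma orbit_refl (x : X) : orbit x x.
Proof. by exists f; rewrite act_min. Qed.

Lemma orbit_eq (x y : X) : orbit x y -> orbit y = orbit x.
Proof.
move=> [t <-]; have [t' [_ _ t'K]] := act_inverse t.
apply/seteqP; split=> z [a <-].
- by exists (a * t); rewrite actM.
- by exists (a * t'); rewrite actM t'K.
Qed.

(** Orbits are indexed by the subsets of [X] that they are, so that a point
    determines its index; [choice] supplies the base points. *)
Lemma locally_free_decomposition : exists (I : Type) (I0 : inhabited I),
  act_isomorphic X (disjoint_union I0 (fun _ : I => principal_act f)).
Proof.
pose I := {O : set X | exists x, O = orbit x}.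
have I0 : inhabited I.
  by case: (act_nonempty X) => x; split; exists (orbit x), x.
exists I, I0.
have [r rP] : {r : I -> X & forall i, sval i = orbit (r i)}.
  by apply: (@choice _ _ (fun i x => sval i = orbit x)) => -[].
pose psi (p : disjoint_union I0 (fun _ : I => principal_act f)) : X :=
  act (sval (projT2 p)) (r (projT1 p)).
apply: (@act_isomorphic_from _ _ psi).
- move=> [i [u fu]] [j [v fv]]; rewrite /psi /= => uv.
  have ij : i = j.
    case: i j uv (rP i) (rP j) => [O hO] [P hP] /= uv rO rP'.
    apply: eq_exist; rewrite /= rO rP'.
    rewrite -(@orbit_eq _ (act u (r (exist _ O hO)))); last by exists u.
    by rewrite uv; apply: orbit_eq; exists v.
  case: j / ij uv => /act_free uv; congr existT; apply: eq_exist.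
  by rewrite -(principal_mulf fu) uv (principal_mulf fv).
- move=> x; pose i : I := exist _ (orbit x) (ex_intro _ x erefl).
  (* [r i] is the base point of the orbit of [x], not [x] itself. *)
  have : orbit (r i) x by rewrite -rP; exact: orbit_refl.
  move=> [t tx]; exists (existT _ i (exist _ (t * f) (ex_intro _ t erefl))).
  by rewrite /psi /= actM act_min.
- by move=> t [i [u fu]]; rewrite /psi /= actM.
Qed.

(** [t * s] fixes [x] exactly when [t * f] inverts [s * f] in [Sf], whatever
    the point [x]. *)
Lemma key_setE (x : X) : key_set s x = upclosure (weak_inverses s).
Proof.
rewrite upclosure_weak_inversesE; apply/seteqP.
by split=> t tsf; apply/(act_fixE (t * s) x).
Qed.

End LocallyFree.
End MinimumIdempotent.

Theorem theorem3p10 (S : semigroupType) (S_fin : finite_set [set: S])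
    (S_dense : e_dense S) (S_slat : semilattice_idempotents S)
    (s : S) (X : sact S) (f : S) (f_min : min_idempotent f) :
  (locally_free_cryptosystem X s <->
     exists (I : Type) (I0 : inhabited I),
       act_isomorphic X (disjoint_union I0 (fun _ : I => principal_act f)))
  /\
  (e_unitary S -> locally_free_cryptosystem X s ->
     forall x : X, key_set s x #= upclosure (weak_inverses s)).
Proof.
split; first split.
- exact: locally_free_decomposition.
- move=> [I [I0 XI]]; apply: act_isomorphic_locally_free XI _.
  apply: disjoint_union_locally_free => _.
  exact: principal_act_locally_free.
- move=> _ X_lf x; rewrite (key_setE S_dense S_slat f_min X_lf).
  exact: card_eqxx.
Qed.
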